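(* Let $n\ge 1$, let $\Lambda_C\subset\mathbb{R}^n$ be an $n$-dimensional (full-rank) lattice, let $\sigma_Z>0$, and let $\mathbf{Z}$ be a random vector in $\mathbb{R}^n$ whose components are i.i.d. Gaussian $N(0,\sigma_Z^2)$. Let $$D_C=\frac{1}{n}E_{\mathbf{Z}}\left[\|Q_{\Lambda_C}(\mathbf{Z})\|^2\right]=\frac{1}{n}\sum_{\mathbf{l}_C\in\Lambda_C}\|\mathbf{l}_C\|^2\,P\left(\mathbf{Z}\in\mathcal{V}_C(\mathbf{l}_C)\right),$$ where $Q_{\Lambda_C}$ is the nearest-neighbor quantizer of $\Lambda_C$ and $\mathcal{V}_C(\mathbf{l}_C)$ is the Voronoi cell of $\mathbf{l}_C$. Then $$D_C\le -\frac{1}{2\pi n}\,\Theta_{\Lambda_C}'\left(\frac{1}{8\pi\sigma_Z^2}\right),$$ where $\Theta_{\Lambda_C}'$ denotes the derivative with respect to $\tau$ of the theta series $\Theta_{\Lambda_C}(\tau)$, that is, $$\Theta_{\Lambda_C}'(\tau)=-\sum_{\mathbf{l}\in\Lambda_C}\pi\|\mathbf{l}\|^2 e^{-\pi\tau\|\mathbf{l}\|^2},\qquad \tau>0.$$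
   Context: An $n$-dimensional lattice is $\Lambda=\{\mathbf{M}\mathbf{i}:\mathbf{i}\in\mathbb{Z}^n\}$ where $\mathbf{M}$ is an $n\times n$ real matrix with linearly independent columns; $\|\cdot\|$ is the Euclidean norm. The nearest-neighbor quantizer is $Q_\Lambda(\mathbf{x})=\arg\min_{\mathbf{l}\in\Lambda}\|\mathbf{x}-\mathbf{l}\|$ (ties, which occur on a set of Lebesgue measure zero, are broken by any fixed measurable rule). The Voronoi cell of a lattice point $\mathbf{l}\in\Lambda$ is $\{\mathbf{x}\in\mathbb{R}^n: Q_\Lambda(\mathbf{x})=\mathbf{l}\}$; for the lattice $\Lambda_C$ it is denoted $\mathcal{V}_C(\mathbf{l})$. The theta series of $\Lambda$ is, for real $\tau>0$, $\Theta_\Lambda(\tau)=\sum_{\mathbf{x}\in\Lambda}e^{-\pi\tau\|\mathbf{x}\|^2}$. The quantity $D_C$ is the ''channel-coding component'' of the per-dimension distortion of Wyner-Ziv coding with nested lattices whose coarse lattice is $\Lambda_C$, with correlation noise $\mathbf{Z}$. *)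

(* Defs.v *)
From HB Require Import structures.
From mathcomp Require Import all_boot all_order all_algebra.
From mathcomp Require Import all_classical all_reals all_analysis.
Import Order.TTheory GRing.Theory Num.Theory.
Import numFieldNormedType.Exports.

Set Implicit Arguments.
Unset Strict Implicit.
Unset Printing Implicit Defensive.

Local Open Scope classical_set_scope.
Local Open Scope ring_scope.

(* The norm that the library puts on matrices is the sup norm, hence this
   separate Euclidean norm. *)
Definition enorm (R : realType) (n : nat) (x : 'cV[R]_n) : R :=
  Num.sqrt (\sum_(i < n) x i 0 ^+ 2).

Definition lattice (R : realType) (n : nat) (M : 'M[R]_n) : set 'cV[R]_n :=
  [set M *m map_mx intr i | i in [set: 'cV[int]_n]].

(* Column vectors with the Borel sigma-algebra of R^n, generated by the
   coordinate functions (as the library does for n.-tuple R). *)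
Definition coord_preimages (R : realType) (n : nat) : set (set 'cV[R]_n) :=
  \big[setU/set0]_(i < n)
     preimage_set_system setT (fun x : 'cV[R]_n => x i 0) measurable.

Definition borel_cV (R : realType) (n : nat) :=
  g_sigma_algebraType (@coord_preimages R n).

HB.instance Definition _ (R : realType) (n : nat) :=
  Measurable.on (borel_cV R n).

(* Ties are resolved by Q itself, through any measurable rule. *)
Definition nearest_neighbor_quantizer (R : realType) (n : nat)
    (L : set 'cV[R]_n) (Q : 'cV[R]_n -> 'cV[R]_n) : Prop :=
  measurable_fun [set: borel_cV R n] (Q : borel_cV R n -> borel_cV R n) /\
  forall x, L (Q x) /\ forall l, L l -> enorm (x - Q x) <= enorm (x - l).

Definition voronoi_cell (R : realType) (n : nat) (Q : 'cV[R]_n -> 'cV[R]_n)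
    (l : 'cV[R]_n) : set 'cV[R]_n :=
  [set x | Q x = l].

(* The terms are nonnegative, so the unordered sum esum is the sum of the
   series in [0, +oo]; fine reads it back as a real number. *)
Definition theta (R : realType) (n : nat) (L : set 'cV[R]_n) (tau : R) : R :=
  fine (\esum_(x in L) (expR (- (pi * tau * enorm x ^+ 2)))%:E).

Definition random_vector (d : measure_display) (T : measurableType d)
    (R : realType) (P : probability T R) (n : nat)
    (Z : 'I_n -> {RV P >-> R}) (w : T) : 'cV[R]_n :=
  \col_i Z i w.

Definition mutually_independent (d : measure_display) (T : measurableType d)
    (R : realType) (P : probability T R) (n : nat)
    (Z : 'I_n -> {RV P >-> R}) : Prop :=
  forall (J : {set 'I_n}) (B : 'I_n -> set R),
    (forall i, measurable (B i)) ->
    P (\bigcap_(i in [set` J]) (Z i @^-1` B i)) =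
    (\prod_(i in J) P (Z i @^-1` B i))%E.

(* s is the standard deviation. The laws are compared on measurable sets only:
   the value of a measure on other sets is irrelevant. *)
Definition iid_gaussian (d : measure_display) (T : measurableType d)
    (R : realType) (P : probability T R) (n : nat)
    (Z : 'I_n -> {RV P >-> R}) (s : R) : Prop :=
  mutually_independent Z /\
  forall (i : 'I_n) (B : set R), measurable B ->
    distribution P (Z i) B = normal_prob 0 s B.

(* Valued in \bar R, so that finiteness is not presupposed. *)
Definition channel_distortion (d : measure_display) (T : measurableType d)
    (R : realType) (P : probability T R) (n : nat)
    (Q : 'cV[R]_n -> 'cV[R]_n) (Z : 'I_n -> {RV P >-> R}) : \bar R :=
  ((n%:R^-1)%:E *
   'E_P[fun w => (enorm (Q (random_vector Z w)) ^+ 2)%R])%E.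

(* Main.v *)
(* If Q(Z) = l then Z is at least as close to l as to 0, that is
   <l, Z> >= |l|^2 / 2. The variable <l, Z> is centred Gaussian of standard
   deviation sigma |l|, and P(N(0, s^2) >= m) <= e^(-m^2 / (2 s^2)) / 2 for
   m >= 0; hence P(Q(Z) = l) <= e^(-|l|^2 / (8 sigma^2)) / 2 for l != 0. Summed
   against |l|^2, this bound is the termwise derivative of the theta series at
   1 / (8 pi sigma^2). *)
Require Import Defs.
From mathcomp Require Import all_boot all_order all_algebra finmap.
From mathcomp Require Import all_classical all_reals all_analysis.
From mathcomp Require Import measurable_realfun normal_distribution.
From mathcomp Require Import lebesgue_integral_under.
From mathcomp Require Import lra ring zify.
Import Order.TTheory GRing.Theory Num.Theory.
Import numFieldNormedType.Exports.

Local Open Scope classical_set_scope.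
Local Open Scope ring_scope.
Set Implicit Arguments.
Unset Strict Implicit.
Unset Printing Implicit Defensive.

(** That [<l, Z>] is Gaussian is the longest step: it reduces to the sum of two independent
    Gaussians, a computation on densities, iterated over the coordinates. A partial sum whose
    coefficients all vanish has no density, so the induction must pass separately over leading zero
    coefficients. The factor 1/2 in the tail bound is essential: it equals the ratio pi / (2 pi)
    left between the differentiated theta series and the claimed bound, and a plain Chernoff
    estimate would lose a factor 2. Termwise differentiation is an exchange of limits. The factor
    |l|^2 it produces is absorbed by lowering tau, so the theta series must converge at every tau >
    0. Convergence comes from bounding |l|^2 below by a multiple of the l1 norm of the integer
    coordinates of l, which yields a product of geometric series. It also makes [fine] faithful in
    [theta], since [fine] sends +oo to 0. *)

(* The instance is named because its measurability argument is not inferred. *)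
Definition image_measure d d' (T : measurableType d) (T' : measurableType d')
    (R : realType) (m : {measure set T -> \bar R}) (f : T -> T')
    (mf : measurable_fun setT f) : {measure set T' -> \bar R} :=
  @measure_function_pushforward__canonical__measure_function_Measure
    _ _ _ _ _ m _ mf.

(** * Affine change of variables for Lebesgue measure *)

Section Affine.
Context {R : realType}.
Local Notation leb := (@lebesgue_measure R).

Lemma measurable_affine (a b : R) :
  measurable_fun setT (fun x : R => a * x + b).
Proof. by apply: measurable_funD => //; exact: measurable_funM. Qed.

(** Lebesgue measure is determined by its values on the intervals []x, y]], so it suffices to
    compare there with |a| times its image under the affine map. A negative a exchanges the two
    ends, whence the second case with intervals closed on the left. *)
Lemma lebesgue_measure_affine (a b : R) (A : set R) : a != 0 -> measurable A ->
  leb ((fun x => a * x + b) @^-1` A) = (`|a|^-1%:E * leb A)%E.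
Proof.
move=> a0 mA.
pose phi x : R := a * x + b.
have mphi : measurable_fun setT (phi : measurableTypeR R -> measurableTypeR R).
  exact: measurable_affine.
have na0 : 0 < `|a| by rewrite normr_gt0.
pose nu := mscale (NngNum (ltW na0)) (image_measure leb mphi).
suff H : forall A, measurable A -> leb A = nu A.
  rewrite (H _ mA).
  change (leb (phi @^-1` A) = (`|a|^-1%:E * (`|a|%:E * leb (phi @^-1` A)))%E).
  rewrite muleA -EFinM mulVf ?gt_eqF// mul1e//.
apply: (@lebesgue_measure_unique R nu) => X.
move=> -[[x y] _ <-].
change (leb `]x, y] = (`|a|%:E * leb (phi @^-1` `]x, y]))%E).
rewrite lebesgue_measure_itv/= lte_fin.
have [pa|an|a00] := ltgtP 0 a; last by rewrite -a00 eqxx in a0.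
- rewrite (_ : phi @^-1` `]x, y] = `](x - b) / a, (y - b) / a]%classic);
    last first.
    apply/seteqP; split => z /=; rewrite /phi !in_itv/=;
    by rewrite ltr_pdivrMr// ler_pdivlMr// ltrBlDr lerBrDr mulrC.
  rewrite lebesgue_measure_itv/= lte_fin ltr_pM2r ?invr_gt0// ltrD2r.
  case: ifP => _; last by rewrite mule0.
  by rewrite -!EFinB -EFinM gtr0_norm//; congr EFin; field; rewrite gt_eqF.
- rewrite (_ : phi @^-1` `]x, y] = `[(y - b) / a, (x - b) / a[%classic);
    last first.
    apply/seteqP; split => z /=; rewrite /phi !in_itv/=;
    by rewrite ltr_ndivlMr// ler_ndivrMr// ltrBlDr lerBrDr mulrC andbC.
  rewrite lebesgue_measure_itv/= lte_fin ltr_nM2r ?invr_lt0// ltrD2r.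
  case: ifP => _; last by rewrite mule0.
  by rewrite -!EFinB -EFinM ltr0_norm//; congr EFin; field; rewrite lt_eqF.
Qed.

Lemma integral_affine (a b : R) (f : R -> \bar R) : a != 0 ->
  measurable_fun setT f -> (forall x, (0 <= f x)%E) ->
  (\int[leb]_x f (a * x + b)%R = `|a|^-1%:E * \int[leb]_x f x)%E.
Proof.
move=> a0 mf f0.
have mphi := measurable_affine a b.
have na0 : 0 <= `|a|^-1 by rewrite invr_ge0.
have mphi' : measurable_fun setT
  ((fun x => a * x + b) : measurableTypeR R -> measurableTypeR R) by [].
pose m1 : {measure set (measurableTypeR R) -> \bar R} := image_measure leb
  mphi'.
pose m2 : {measure set (measurableTypeR R) -> \bar R} := mscale (NngNum na0)
  leb.
transitivity (\int[m1]_x f x)%E.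
  by rewrite ge0_integral_pushforward.
transitivity (\int[m2]_x f x)%E; last first.
  by rewrite ge0_integral_mscale.
apply: eq_measure_integral => A mA _.
exact: lebesgue_measure_affine.
Qed.

End Affine.

(** * Centred Gaussian laws: scaling, symmetry and convolution *)

Section Gaussian.
Context {R : realType}.
Local Notation leb := (@lebesgue_measure R).
Local Notation pdf := (normal_pdf (0 : R)).
Local Notation gauss := (normal_prob (0 : R)).

(** The explicit density and the Radon-Nikodym derivative have the same integral over every
    measurable set, hence agree almost everywhere. *)
Lemma integral_normal_prob (m s : R) (f : R -> \bar R) :
  (normal_prob m s).-integrable setT f ->
  (\int[normal_prob m s]_x f x = \int[leb]_x (f x * (normal_pdf m s x)%:E))%E.
Proof.
move=> fi; have dom := normal_prob_dominates m s.
have mf := measurable_int _ fi.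
rewrite -(Radon_Nikodym_change_of_variables dom)//=.
apply: ae_eq_integral => //=.
- by apply: emeasurable_funM => //; exact: (measurable_int leb).
- apply: emeasurable_funM => //; apply/measurable_EFinP.
  exact: measurable_normal_pdf.
- apply: ae_eqe_mul2l => /=; apply: integral_ae_eq => //=.
  + exact: Radon_Nikodym_integrable.
  + by apply/measurable_EFinP; exact: measurable_normal_pdf.
  + by move=> E _ mE; rewrite -Radon_Nikodym_integral.
Qed.

Lemma normal_prob_setTE (s : R) (C : set R) : measurable C ->
  gauss s C = (\int[leb]_x ((\1_C x)%:E * (pdf s x)%:E))%E.
Proof.
move=> mC; rewrite /normal_prob integral_mkcond; apply: eq_integral => x _.
by rewrite patchE indicE; case: (x \in C); rewrite ?mul1e ?mul0e.
Qed.

Lemma normal_pdf_scale (s a x : R) : s != 0 -> a != 0 ->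
  pdf s x = `|a| * pdf (a * s) (a * x).
Proof.
move=> s0 a0; rewrite !normal_pdfE ?mulf_neq0// /normal_peak /normal_fun.
have -> : Num.sqrt ((a * s) ^+ 2 * pi *+ 2) =
  `|a| * Num.sqrt (s ^+ 2 * pi *+ 2).
  have -> : (a * s) ^+ 2 * pi *+ 2 = a ^+ 2 * (s ^+ 2 * pi *+ 2) by ring.
  by rewrite sqrtrM ?sqr_ge0// sqrtr_sqr.
rewrite !subr0 invfM !mulrA.
rewrite divff ?normr_eq0// mul1r; congr (_ * expR _).
by field; rewrite s0 a0.
Qed.

Lemma normal_prob_scale (s a : R) (C : set R) : s != 0 -> a != 0 ->
  measurable C -> gauss s ((fun x => a * x) @^-1` C) = gauss (a * s) C.
Proof.
move=> s0 a0 mC.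
have mpre : measurable ((fun x => a * x) @^-1` C).
  by rewrite -[X in measurable X]setTI; exact: measurable_funM.
rewrite !normal_prob_setTE//.
have na0 : 0 < `|a| by rewrite normr_gt0.
pose f x := ((\1_C x)%:E * (pdf (a * s) x)%:E)%E.
have mf : measurable_fun setT f.
  apply: emeasurable_funM; first by apply/measurable_EFinP.
  by apply/measurable_EFinP; exact: measurable_normal_pdf.
have f0 x : (0 <= f x)%E.
  by rewrite /f -EFinM lee_fin mulr_ge0// normal_pdf_ge0.
transitivity (`|a|%:E * \int[leb]_x f (a * x + 0)%R)%E; last first.
  by rewrite integral_affine// muleA -EFinM divff ?gt_eqF// mul1e.
rewrite -ge0_integralZl//=; last first.
  exact: (measurableT_comp mf (measurable_affine a 0)).
apply: eq_integral => x _; rewrite addr0 /f (@normal_pdf_scale s a)//.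
by rewrite EFinM muleCA; congr (_ * (_ * _))%E.
Qed.

(** The density sees s only through s^2 and the test s = 0. Scaling by a negative factor produces a
    negative parameter [a * s], which this brings back to a standard deviation. *)
Lemma normal_prob_abs (s : R) (C : set R) : gauss `|s| C = gauss s C.
Proof.
apply: eq_integral => x _; congr EFin; rewrite /normal_pdf normr_eq0.
by rewrite /normal_peak /normal_fun real_normK ?num_real.
Qed.

Lemma normal_prob_opp (s : R) (C : set R) : s != 0 -> measurable C ->
  gauss s (-%R @^-1` C) = gauss s C.
Proof.
move=> s0 mC; have a0 : -1 != 0 :> R by rewrite oppr_eq0 oner_neq0.
transitivity (gauss s ((fun x => -1 * x) @^-1` C)).
  by congr (gauss s _); apply/seteqP; split => x /=; rewrite mulN1r.
by rewrite normal_prob_scale// -normal_prob_abs mulN1r normrN normal_prob_abs.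
Qed.

(* Completing the square in y. *)
Lemma normal_pdf_convolution (v s l x y : R) : v != 0 -> s != 0 ->
  let w := Num.sqrt (v ^+ 2 + (l * s) ^+ 2) in
  pdf s y * pdf v (x - l * y) =
  pdf w x * normal_pdf (l * s ^+ 2 * x / w ^+ 2) (s * v / w) y.
Proof.
move=> v0 s0 w.
have v2 : 0 < v ^+ 2 by rewrite exprn_even_gt0.
have s2 : 0 < s ^+ 2 by rewrite exprn_even_gt0.
have w2 : 0 < v ^+ 2 + (l * s) ^+ 2 by rewrite ltr_wpDr// sqr_ge0.
have wE : w ^+ 2 = v ^+ 2 + (l * s) ^+ 2 by rewrite sqr_sqrtr// ltW.
have w0 : w != 0 by rewrite gt_eqF// sqrtr_gt0.
rewrite !normal_pdfE ?mulf_neq0 ?invr_eq0// /normal_peak /normal_fun !subr0.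
rewrite mulrACA [RHS]mulrACA; congr (_ * _).
  rewrite -!invfM -!sqrtrM; last 2 first.
  - by rewrite mulrn_wge0// mulr_ge0 ?sqr_ge0// pi_ge0.
  - by rewrite mulrn_wge0// mulr_ge0 ?sqr_ge0// pi_ge0.
  by congr (Num.sqrt _)^-1; field.
rewrite -!expRD; congr expR; rewrite !expr_div_n !exprMn.
have -> : (x - l * y) ^+ 2 = x ^+ 2 - 2 * (l * x * y) + l ^+ 2 * y ^+ 2 by ring.
rewrite wE exprMn; field.
by rewrite v0 s0 gt_eqF.
Qed.

Lemma normal_prob_translate (v c : R) (C : set R) : measurable C ->
  gauss v ((fun x => x + c) @^-1` C) =
  (\int[leb]_x ((\1_C x)%:E * (pdf v (x - c))%:E))%E.
Proof.
move=> mC; rewrite normal_prob_setTE; last first.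
  by rewrite -[X in measurable X]setTI; exact: measurable_funD.
pose f x := ((\1_C x)%:E * (pdf v (x - c))%:E)%E.
have mf : measurable_fun setT f.
  apply: emeasurable_funM; first by apply/measurable_EFinP.
  apply/measurable_EFinP; apply: (measurableT_comp (measurable_normal_pdf 0 v)).
  exact: measurable_funB.
have f0 x : (0 <= f x)%E.
  by rewrite /f -EFinM lee_fin mulr_ge0// normal_pdf_ge0.
have := @integral_affine R 1 c f (oner_neq0 _) mf f0.
rewrite normr1 invr1 mul1e => <-; apply: eq_integral => x _.
by rewrite /f mul1r addrK.
Qed.

(** This is the law of X + l Y for independent centred Gaussians X and Y. Its mass on C is a double
    Lebesgue integral; Tonelli makes y the inner variable, and completing the square splits off a
    normal density in y, whose integral is 1. *)
Lemma normal_prob_convolution (v s l : R) (C : set R) :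
  v != 0 -> s != 0 -> measurable C ->
  (gauss s \x gauss v)%E [set p : R * R | C (p.2 + l * p.1)] =
  gauss (Num.sqrt (v ^+ 2 + (l * s) ^+ 2)) C.
Proof.
move=> v0 s0 mC; set w := Num.sqrt _; set A := [set p | _].
have madd : measurable_fun setT (fun p : R * R => p.2 + l * p.1).
  apply: measurable_funD; first exact: measurable_snd.
  by apply: measurable_funM => //; exact: measurable_fst.
have mA : measurable A.
  by have := madd measurableT C mC; rewrite setTI.
have mF : measurable_fun setT (gauss v \o xsection A).
  exact: measurable_fun_xsection.
have iF : (gauss s).-integrable setT (gauss v \o xsection A).
  apply: (@le_integrable _ _ _ (gauss s) setT measurableT _ (cst 1%E)) => //=.
    move=> y _; rewrite normr1 gee0_abs//.
    by apply: probability_le1; exact: measurable_xsection.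
  exact: finite_measure_integrable_cst.
rewrite /= /product_measure1 integral_normal_prob//.
pose F (p : R * R) := ((\1_C p.2)%:E * (pdf s p.1 * pdf v (p.2 - l *
  p.1))%:E)%E.
have mpdf (u : R) := measurable_normal_pdf 0 u.
have mF' : measurable_fun setT F.
  apply: emeasurable_funM.
    have mi : measurable_fun setT (\1_C : R -> R) by exact: measurable_indic.
    by apply/measurable_EFinP; exact: (measurableT_comp mi measurable_snd).
  apply/measurable_EFinP; apply: measurable_funM.
    exact: (measurableT_comp (mpdf s) measurable_fst).
  apply: (measurableT_comp (mpdf v)).
  apply: measurable_funB; first exact: measurable_snd.
  by apply: measurable_funM => //; exact: measurable_fst.
have F0 p : (0 <= F p)%E.
  by rewrite /F -EFinM lee_fin !mulr_ge0// normal_pdf_ge0.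
transitivity (\int[leb]_y \int[leb]_x F (y, x))%E.
  apply: eq_integral => y _ /=.
  have -> : xsection A y = (fun x => x + l * y) @^-1` C.
    by apply/seteqP; split => x; rewrite /xsection/= inE.
  rewrite normal_prob_translate// -ge0_integralZr//=; last first.
  - by rewrite lee_fin normal_pdf_ge0.
  - by move=> x _; rewrite -EFinM lee_fin mulr_ge0// normal_pdf_ge0.
  - apply: emeasurable_funM; apply/measurable_EFinP;
      first exact: measurable_indic.
    by apply: (measurableT_comp (mpdf v)); exact: measurable_funB.
  apply: eq_integral => x _; rewrite /F/= EFinM -muleA; congr (_ * _)%E.
  by rewrite muleC.
transitivity (\int[leb]_x \int[leb]_y F (y, x))%E.
  exact: (@fubini_tonelli _ _ _ _ _ leb leb F).
rewrite normal_prob_setTE//.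
apply: eq_integral => x _.
pose m1 := l * s ^+ 2 * x / w ^+ 2.
under eq_integral do rewrite /F/= normal_pdf_convolution// -/w -/m1 EFinM muleA.
rewrite ge0_integralZl//; last 3 first.
- by apply/measurable_EFinP; exact: measurable_normal_pdf.
- by move=> y _; rewrite lee_fin normal_pdf_ge0.
- by rewrite -EFinM lee_fin mulr_ge0// normal_pdf_ge0.
by rewrite integral_normal_pdf mule1.
Qed.

End Gaussian.

(** * The Gaussian tail bound with its factor 1/2 *)

Section GaussianTail.
Context {R : realType}.
Local Notation leb := (@lebesgue_measure R).
Local Notation gauss := (normal_prob (0 : R)).

(** By symmetry and the absence of an atom at 0, the two half-lines have equal masses, which add up
    to 1. *)
Lemma normal_prob_half (s : R) : s != 0 ->
  gauss s `[0, +oo[%classic = 2^-1%:E.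
Proof.
move=> s0.
have g0 : gauss s [set 0] = 0%E.
  apply: null_set_integral => //; last exact: lebesgue_measure_set1.
  by apply/measurable_EFinP/measurable_funTS; exact: measurable_normal_pdf.
have gN : gauss s `]-oo, 0] = gauss s `[0, +oo[%classic.
  rewrite -[RHS]normal_prob_opp//; congr (gauss s _).
  by apply/seteqP; split => x /=; rewrite !in_itv/= andbT oppr_ge0.
have gT : (gauss s `]-oo, 0%R[ + gauss s `[0%R, +oo[ = 1)%E.
  rewrite -(probability_setT (gauss s)) -measureU//.
    by congr (gauss s _); apply/seteqP; split => x //= _;
      rewrite !in_itv/= andbT; case: ltP; [left|right].
  by apply/seteqP; split => x //=; rewrite !in_itv/= andbT => -[]; case: ltP.
have gE : gauss s `]-oo, 0] = gauss s `]-oo, 0[%classic.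
  have -> : `]-oo, 0]%classic = `]-oo, 0[%classic `|` [set 0] :> set R.
    apply/seteqP; split => x /=; rewrite !in_itv/= le_eqVlt.
      by move=> /orP[/eqP->|->]; [right|left].
    by move=> [->|->]; rewrite ?eqxx ?orbT.
  rewrite measureU//; first by rewrite [X in (_ + X)%E]g0 adde0.
  by apply/seteqP; split => x //=; rewrite !in_itv/= => -[] + xE;
    rewrite xE ltxx.
move: gT; rewrite -gE gN.
have : gauss s `[0, +oo[%classic \is a fin_num by rewrite fin_num_measure.
case: (gauss s _) => // r _ /eqP; rewrite -EFinD eqe => /eqP r1.
by congr EFin; lra.
Qed.

(** After a shift by m, the density at x + m is compared with the one at x >= 0: (x + m)^2 >= x^2 +
    m^2 extracts the exponential factor, and the remaining half-line has mass 1/2. *)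
Lemma normal_prob_tail (s m : R) : s != 0 -> 0 <= m ->
  (gauss s `[m, +oo[%classic <= (2^-1 * expR (- (m ^+ 2 / (2 * s ^+ 2))))%:E)%E.
Proof.
move=> s0 m0; set e := expR _.
have -> : `[m, +oo[%classic = (fun x => x + - m) @^-1` `[0, +oo[%classic.
  by apply/seteqP; split => x /=; rewrite !in_itv/= !andbT subr_ge0.
rewrite normal_prob_translate// mulrC EFinM -(normal_prob_half s0).
rewrite normal_prob_setTE// -ge0_integralZl//=; last 3 first.
- apply: emeasurable_funM; first by apply/measurable_EFinP;
    exact: measurable_indic.
  by apply/measurable_EFinP; exact: measurable_normal_pdf.
- by move=> x _; rewrite -EFinM lee_fin mulr_ge0// normal_pdf_ge0.
- by rewrite lee_fin expR_ge0.
apply: ge0_le_integral => //=.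
- by move=> x _; rewrite -EFinM lee_fin mulr_ge0// normal_pdf_ge0.
- apply: emeasurable_funM; apply/measurable_EFinP;
    first exact: measurable_indic.
  apply: (measurableT_comp (measurable_normal_pdf 0 s)).
  exact: measurable_funB.
- apply: emeasurable_funM => //; apply: emeasurable_funM;
    apply/measurable_EFinP.
    exact: measurable_indic.
  exact: measurable_normal_pdf.
move=> x _; rewrite indicE; case: (boolP (x \in _)) => x0;
  last by rewrite !mul0e mule0.
move: x0; rewrite inE/= in_itv/= andbT => x0.
rewrite !mul1e -EFinM lee_fin !normal_pdfE// mulrCA.
rewrite ler_wpM2l ?normal_peak_ge0// /normal_fun /e -expRD ler_expR.
rewrite !subr0 opprK -mulr_natl !mulNr -opprD lerN2 -mulrDl.
have s2 : 0 < 2 * s ^+ 2 by rewrite mulr_gt0// exprn_even_gt0.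
rewrite ler_pM2r ?invr_gt0//.
by rewrite sqrrD addrC -subr_ge0; nra.
Qed.

End GaussianTail.

(** * Linear combinations of independent Gaussian coordinates *)

Section LinearCombination.
Context {R : realType} d (T : measurableType d) (P : probability T R) (n : nat).
Variables (Z : 'I_n -> {RV P >-> R}) (s : R) (a : 'I_n -> R).
Hypotheses (s_gt0 : 0 < s) (Z_iid : iid_gaussian Z s).
Local Notation gauss := (normal_prob (0 : R)).

Let S k w : R := \sum_(i < n | (i < k)%N) a i * Z i w.
Let V k : R := Num.sqrt (\sum_(i < n | (i < k)%N) (a i * s) ^+ 2).
Let E k (B : 'I_n -> set R) : set T :=
  \bigcap_(i in [set` [set i : 'I_n | (k <= i)%N]%SET]) (Z i @^-1` B i).

Let mZ i (B : set R) : measurable B -> measurable (Z i @^-1` B).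
Proof. by move=> mB; rewrite -[X in measurable X]setTI;
  exact: measurable_funP. Qed.

Let mS k : measurable_fun setT (S k).
Proof.
have -> : S k = fun w => \sum_(i < n) if (i < k)%N then a i * Z i w else 0.
  by apply/funext => w; rewrite /S big_mkcond.
apply: measurable_sum => i; case: (i < k)%N => //.
exact: (measurable_funM (measurable_cst (a i)) (measurable_funPT (Z i))).
Qed.

Let mE k B : (forall i, measurable (B i)) -> measurable (E k B).
Proof. by move=> mB; apply: fin_bigcap_measurable => // i _; exact: mZ. Qed.

Let SS (k : 'I_n) w : S k.+1 w = S k w + a k * Z k w.
Proof.
rewrite /S (bigD1 k)//= addrC; congr (_ + _); apply: eq_bigl => i.
by rewrite ltnS leq_eqVlt -val_eqE/=; case: ltngtP.
Qed.

Let VS (k : 'I_n) : V k.+1 = Num.sqrt (V k ^+ 2 + (a k * s) ^+ 2).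
Proof.
rewrite /V sqr_sqrtr; last by apply: sumr_ge0 => i _; exact: sqr_ge0.
rewrite (bigD1 k)//= addrC; congr (Num.sqrt (_ + _)); apply: eq_bigl => i.
by rewrite ltnS leq_eqVlt -val_eqE/=; case: ltngtP.
Qed.

Let ES (k : 'I_n) B : E k B = Z k @^-1` B k `&` E k.+1 B.
Proof.
apply/seteqP; split => w.
  move=> H; split; first by apply: (H k); rewrite /= inE.
  by move=> i /= ki; apply: (H i); move: ki; rewrite /= !inE; exact: ltnW.
move=> [Hk H] i /=; rewrite inE leq_eqVlt => /orP[/eqP/val_inj <-//|ki].
by apply: (H i); rewrite /= inE.
Qed.

Let PE k B : (forall i, measurable (B i)) ->
  P (E k B) = (\prod_(i < n | (k <= i)%N) P (Z i @^-1` B i))%E.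
Proof.
move=> mB; rewrite (Z_iid.1 [set i : 'I_n | (k <= i)%N]%SET B mB).
by apply: eq_bigl => i; rewrite inE.
Qed.

Let PES (k : 'I_n) B : (forall i, measurable (B i)) ->
  P (E k B) = (gauss s (B k) * P (E k.+1 B))%E.
Proof.
move=> mB; rewrite !PE// (bigD1 k)//=; congr (_ * _)%E.
  exact: (Z_iid.2 k (B k) (mB k)).
by apply: eq_bigl => i; rewrite -val_eqE/=; case: ltngtP.
Qed.

(** Zero variance forces every coefficient used so far to vanish. This case is kept apart because
    [normal_prob] always has a density, so at parameter 0 it is not the law of the constant 0. *)
Let V0 k : V k = 0 -> forall w, S k w = 0.
Proof.
move=> /eqP; rewrite sqrtr_eq0 => V0 w; rewrite /S big1// => i ik.
suff -> : a i = 0 by rewrite mul0r.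
have : \sum_(i < n | (i < k)%N) (a i * s) ^+ 2 = 0.
  by apply/eqP; rewrite eq_le V0/= sumr_ge0// => j _; exact: sqr_ge0.
move/psumr_eq0P => /(_ (fun i _ => sqr_ge0 _) i ik)/eqP.
by rewrite sqrf_eq0 mulf_eq0 (gt_eqF s_gt0) orbF => /eqP.
Qed.

(* Carrying the events on the remaining coordinates along provides, at the next
   step, the independence of S k and Z k. *)
Let law k : (k <= n)%N -> V k != 0 ->
  forall (C : set R) (B : 'I_n -> set R), measurable C ->
  (forall i, measurable (B i)) ->
  P (S k @^-1` C `&` E k B) = (gauss (V k) C * P (E k B))%E.
Proof.
elim: k => [_|k IH kn].
  by rewrite /V big_pred0// sqrtr0 eqxx.
pose k' := Ordinal kn; have s0 : s != 0 by rewrite gt_eqF.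
move=> VSn0 C B mC mB.
(* [B' A] puts the constraint A on coordinate k and keeps the later ones, so that the induction
   hypothesis at k speaks of [S k] and [Z k] jointly. *)
pose B' (A : set R) i := if i == k' then A else B i.
have mB' A : measurable A -> forall i, measurable (B' A i).
  by move=> mA i; rewrite /B'; case: ifP.
have EB' A : E k.+1 (B' A) = E k.+1 B.
  apply: eq_bigcapr => i /=; rewrite inE /B' => ki.
  by case: eqP ki => // ->; rewrite ltnn.
(* If [V k] is 0, then [S k.+1] is just [a k * Z k]: this is the true start of the induction, at the
   first nonzero coefficient, the case k = 0 being vacuous. *)
have [Vk0|Vkn0] := eqVneq (V k) 0.
  have Vk1 : V k.+1 = `|a k' * s|.
    by rewrite (VS k') Vk0 expr0n add0r sqrtr_sqr.
  have ak0 : a k' != 0.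
    by apply: contraNneq VSn0 => ak0; rewrite Vk1 ak0 mul0r normr0.
  pose A := (fun x => a k' * x) @^-1` C.
  have mA : measurable A.
    by rewrite -[X in measurable X]setTI; exact: measurable_funM.
  have -> : S k.+1 @^-1` C `&` E k.+1 B = E k' (B' A).
    rewrite ES EB'; congr (_ `&` _); rewrite /B' eqxx; apply/seteqP.
    by split => w; rewrite /preimage /= (SS k') V0// add0r.
  rewrite PES; last exact: mB'.
  by rewrite EB' /B' eqxx normal_prob_scale// Vk1 normal_prob_abs.
(* The law of (Z k, S k) restricted to the event on later coordinates is a
   product of Gaussian laws, up to the mass of that event. *)
pose f w : measurableTypeR R * measurableTypeR R := (Z k' w, S k w).
have mf : measurable_fun setT f.
  exact: (measurable_fun_pair (measurable_funPT (Z k')) (mS k)).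
pose m' := image_measure (mrestr P (mE k.+1 mB)) mf.
have PEfin : P (E k.+1 B) \is a fin_num by rewrite fin_num_measure//; exact: mE.
pose c := NngNum (fine_ge0 (measure_ge0 P (E k.+1 B))).
pose m2 := mscale c (gauss (V k)).
pose A : set (measurableTypeR R * measurableTypeR R) :=
  [set p | C (p.2 + a k' * p.1)].
have madd : measurable_fun setT
    (fun p : measurableTypeR R * measurableTypeR R => p.2 + a k' * p.1 : R).
  apply: measurable_funD; first exact: measurable_snd.
  by apply: measurable_funM => //; exact: measurable_fst.
have mA : measurable A.
  by have := madd measurableT C mC; rewrite setTI.
have H : (gauss s \x m2)%E A = m' A.
  (* Agreement on rectangles suffices, and there it is the induction hypothesis with A1 as the
     constraint on coordinate k. *)
  apply: (@product_measure_unique _ _ _ _ _ (gauss s) m2 m') =>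
    // A1 A2 mA1 mA2.
  have -> : m' (A1 `*` A2) = P (S k @^-1` A2 `&` E k' (B' A1)).
    congr (P _); rewrite ES EB' /B' eqxx; apply/seteqP.
    by split => w /=; tauto.
  rewrite IH ?(ltnW kn)//; last exact: mB'.
  rewrite (PES k'); last exact: mB'.
  rewrite EB' /B' eqxx muleCA; congr (_ * _)%E.
  by rewrite muleC -[in LHS](fineK PEfin).
have -> : P (S k.+1 @^-1` C `&` E k.+1 B) = m' A.
  by congr (P (_ `&` _)); apply/seteqP; split => w;
    rewrite /preimage /= (SS k').
rewrite -H (VS k') -(@normal_prob_convolution _ (V k) s)//.
rewrite /= /product_measure1 /m2 -(fineK PEfin) muleC -ge0_integralZl//.
  exact: measurable_fun_xsection.
by rewrite lee_fin fine_ge0.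
Qed.

(** This is [law] at k = n, where no coordinate is left to constrain; a nonzero coefficient makes
    the variance positive. *)
Lemma linear_combination_law (C : set R) : (exists i, a i != 0) ->
  measurable C ->
  P [set w | C (\sum_(i < n) a i * Z i w)] =
  gauss (s * Num.sqrt (\sum_(i < n) a i ^+ 2)) C.
Proof.
move=> [i0 ai0] mC; have s0 : s != 0 by rewrite gt_eqF.
have Sn w : S n w = \sum_(i < n) a i * Z i w.
  by apply: eq_bigl => i; exact: ltn_ord.
have VnE : V n = s * Num.sqrt (\sum_(i < n) a i ^+ 2).
  rewrite /V; have -> : \sum_(i < n | (i < n)%N) (a i * s) ^+ 2 =
      s ^+ 2 * \sum_(i < n) a i ^+ 2.
    by rewrite mulr_sumr; apply: eq_big => [i|i _];
      rewrite ?ltn_ord// exprMn mulrC.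
  by rewrite sqrtrM ?sqr_ge0// sqrtr_sqr gtr0_norm.
have Vn0 : V n != 0.
  rewrite VnE mulf_neq0// gt_eqF// sqrtr_gt0 (bigD1 i0)//=.
  by rewrite ltr_pwDl ?exprn_even_gt0// sumr_ge0// => i _; exact: sqr_ge0.
have ET : E n (fun=> setT) = setT by apply/seteqP; split.
have := law (leqnn n) Vn0 mC (fun=> measurableT).
rewrite ET setIT probability_setT mule1 VnE => <-.
by congr (P _); apply/seteqP; split => w; rewrite /preimage/= Sn.
Qed.

End LinearCombination.

(** * Euclidean norm and measurability of random vectors *)

Section Euclidean.
Context {R : realType} {n : nat}.
Implicit Types x l : 'cV[R]_n.

Lemma enorm_sqr x : enorm x ^+ 2 = \sum_(i < n) x i 0 ^+ 2.
Proof. by rewrite sqr_sqrtr// sumr_ge0// => i _; exact: sqr_ge0. Qed.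

Lemma enorm_ge0 x : 0 <= enorm x.
Proof. exact: sqrtr_ge0. Qed.

Lemma enorm0 : enorm (0 : 'cV[R]_n) = 0.
Proof. by rewrite /enorm big1 ?sqrtr0// => i _; rewrite mxE expr0n. Qed.

(** Squaring cancels |x|^2 on both sides and leaves a half-space, a condition linear in x. *)
Lemma enorm_sub_le x l : enorm (x - l) <= enorm (x - 0) ->
  enorm l ^+ 2 / 2 <= \sum_(i < n) l i 0 * x i 0.
Proof.
rewrite subr0 -(@ler_pXn2r _ 2) ?nnegrE ?enorm_ge0// !enorm_sqr.
have -> : \sum_(i < n) (x - l) i 0 ^+ 2 = \sum_(i < n) x i 0 ^+ 2
    + \sum_(i < n) l i 0 ^+ 2 - 2 * \sum_(i < n) l i 0 * x i 0.
  rewrite mulr_sumr -sumrN -!big_split/=; apply: eq_bigr => i _.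
  by rewrite !mxE; ring.
by lra.
Qed.

Lemma measurable_coord (i : 'I_n) :
  measurable_fun [set: borel_cV R n] (fun x : borel_cV R n =>
    (x : 'cV[R]_n) i 0).
Proof.
move=> _ B mB.
have H : @coord_preimages R n (setT `&` (fun x : 'cV[R]_n => x i 0) @^-1` B).
  by rewrite /coord_preimages (bigD1 i)//=; left; exists B.
exact: sub_gen_smallest H.
Qed.

Lemma measurable_enorm_sqr :
  measurable_fun [set: borel_cV R n] (fun x : borel_cV R n => enorm x ^+ 2).
Proof.
apply: (eq_measurable_fun (fun x : borel_cV R n =>
    \sum_(i < n) (x : 'cV[R]_n) i 0 ^+ 2)) => [x _|].
  by rewrite enorm_sqr.
by apply: measurable_sum => i; apply: measurable_funX; exact: measurable_coord.
Qed.

Lemma measurable_set1_cV (l : 'cV[R]_n) :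
  measurable ([set l] : set (borel_cV R n)).
Proof.
have -> : [set l] = \bigcap_(i in [set: 'I_n]) ((fun x : borel_cV R n =>
    (x : 'cV[R]_n) i 0) @^-1` [set l i 0]).
  apply/seteqP; split => [_ -> i //|x H].
  by apply/colP => i; exact: (H i).
apply: fin_bigcap_measurable => // i _.
rewrite -[X in measurable X]setTI.
exact: measurable_coord.
Qed.

Context d (T : measurableType d) (P : probability T R) (Z : 'I_n -> {RV P >->
  R}).

Lemma measurable_preimage_coord (A : set 'cV[R]_n) :
  coord_preimages A -> measurable (random_vector Z @^-1` A).
Proof.
rewrite /coord_preimages; elim/big_ind: _ => [[]|U V HU HV []|i _ [B mB <-]].
- exact: HU.
- exact: HV.
rewrite setTI (_ : _ @^-1` _ = Z i @^-1` B); last first.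
  by apply/seteqP; split => w; rewrite /preimage/= mxE.
by rewrite -[X in measurable X]setTI; exact: measurable_funPT.
Qed.

Lemma measurable_random_vector :
  measurable_fun [set: T] (random_vector Z : T -> borel_cV R n).
Proof.
apply: (@measurability _ _ T (borel_cV R n) setT (random_vector Z)
  (@coord_preimages R n : set (set (borel_cV R n)))) => //.
by move=> _ [A mA <-]; rewrite setTI; exact: measurable_preimage_coord.
Qed.

End Euclidean.

(** * Probability of a Voronoi cell *)

Section VoronoiCell.
Context {R : realType} {n : nat} (L : set 'cV[R]_n) (Q : 'cV[R]_n -> 'cV[R]_n).
Context d (T : measurableType d) (P : probability T R) (Z : 'I_n -> {RV P >->
  R}).
Variable (s : R).
Hypotheses (s_gt0 : 0 < s) (Z_iid : iid_gaussian Z s).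
Hypotheses (Q_nn : nearest_neighbor_quantizer L Q) (L0 : L 0).

Lemma measurable_voronoi (l : 'cV[R]_n) :
  measurable (random_vector Z @^-1` voronoi_cell Q l).
Proof.
have mQ := measurableT_comp Q_nn.1 (measurable_random_vector Z).
have := mQ measurableT _ (measurable_set1_cV l); rewrite setTI.
by [].
Qed.

Lemma voronoi_cell_prob_le (l : 'cV[R]_n) : l != 0 ->
  (P (random_vector Z @^-1` voronoi_cell Q l) <=
   (2^-1 * expR (- (enorm l ^+ 2 / (8 * s ^+ 2))))%:E)%E.
Proof.
move=> l0.
have [i li0] : exists i, l i 0 != 0.
  apply/not_existsP => H; move/eqP: l0; apply.
  by apply/colP => i; rewrite mxE; apply/eqP; rewrite -[_ == _]negbK;
    exact/negP/H.
have el0 : 0 < enorm l.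
  rewrite sqrtr_gt0 (bigD1 i)//= ltr_pwDl ?exprn_even_gt0//.
  by rewrite sumr_ge0// => j _; exact: sqr_ge0.
set m := enorm l ^+ 2 / 2.
have m0 : 0 <= m by rewrite /m divr_ge0// sqr_ge0.
have law := @linear_combination_law R _ _ P n Z s (fun i => l i 0) s_gt0 Z_iid
  `[m, +oo[%classic (ex_intro _ i li0) (measurable_itv _).
apply: (@le_trans _ _ (normal_prob 0 (s * enorm l) `[m, +oo[%classic)).
  rewrite -law; apply: le_measure; rewrite ?inE//.
  - exact: measurable_voronoi.
  - have mS : measurable_fun setT (fun w => \sum_(i < n) l i 0 * Z i w).
      apply: measurable_sum => j.
      exact: (measurable_funM (measurable_cst (l j 0)) (measurable_funPT (Z
        j))).
    rewrite -[X in measurable X]setTI.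
    exact: (mS measurableT `[m, +oo[%classic).
  - move=> w /= Qw; rewrite in_itv/= andbT /m.
    have := (Q_nn.2 (random_vector Z w)).2 0 L0; rewrite Qw => /enorm_sub_le.
    by under [X in _ <= X -> _]eq_bigr do rewrite mxE.
have sl0 : s * enorm l != 0 by rewrite mulf_neq0// gt_eqF.
apply: le_trans (normal_prob_tail sl0 m0) _.
(* With m = |l|^2 / 2 and standard deviation s |l|, the tail exponent m^2 / (2 s^2 |l|^2) equals
   |l|^2 / (8 s^2). *)
rewrite lee_fin ler_wpM2l// ler_expR lerN2 /m le_eqVlt; apply/orP; left.
by apply/eqP; field; rewrite !gt_eqF.
Qed.

End VoronoiCell.

(** * Geometric sums over integer vectors *)

Section Summability.
Context {R : realType}.

(** The index j stands for the integer j - m in [-m, m]. Cutting at j = m leaves two geometric sums,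
    each at most 1 / (1 - q), so the bound does not depend on m. *)
Lemma sum_expr_distn_le (q : R) (m : nat) : 0 <= q -> q < 1 ->
  \sum_(j < m.*2.+1) q ^+ `|(j%:Z - m%:Z)%R|%N <= 2 / (1 - q).
Proof.
move=> q0 q1.
have geo k : \sum_(0 <= j < k) q ^+ j <= (1 - q)^-1.
  rewrite -[leRHS]mul1r ler_pdivlMr ?subr_gt0// mulrC big_mkord.
  have := subrX1 q k; rewrite -opprB -[q - 1]opprB mulNr => /oppr_inj <-.
  by rewrite gerBl exprn_ge0.
rewrite -(big_mkord xpredT (fun j => q ^+ `|(j%:Z - m%:Z)%R|%N)).
rewrite (@big_cat_nat _ _ _ m)//=; last by rewrite -addnn -addnS leq_addr.
rewrite mulr_natl mulr2n lerD//.
  rewrite big_nat_rev/= add0n; apply: le_trans (geo m).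
  rewrite !big_nat; apply: ler_sum => j /andP[_ jm].
  apply: ler_wiXn2l => //; [exact: ltW|lia].
rewrite -{1}[m]add0n big_addn; apply: le_trans (geo (m.*2.+1 - m)%N).
rewrite !big_nat; apply: ler_sum => j _.
by rewrite PoszD addrK.
Qed.

(** A finite set of integer vectors lies in a cube [-m, m]^n. Over the cube, the sum of products is
    a product of n one-dimensional sums, each bounded independently of m. *)
Lemma esum_prod_expr_lty (n : nat) (q : R) : 0 <= q -> q < 1 ->
  (\esum_(i in [set: 'cV[int]_n]) (\prod_(k < n) q ^+ absz (i k 0))%:E < +oo)%E.
Proof.
move=> q0 q1.
apply: (@le_lt_trans _ _ ((2 / (1 - q)) ^+ n)%:E); last exact: ltry.
apply: ge_ereal_sup => _ [A [finA _] <-].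
pose m := \max_(x <- fset_set A) \max_(k < n) absz (x k 0%R).
pose h (f : {ffun 'I_n -> 'I_m.*2.+1}) : 'cV[int]_n :=
  \col_k ((f k : nat)%:Z - m%:Z).
have mge0 (z : int) : (absz z <= m)%N -> 0 <= z + m%:Z by lia.
have Ah : A `<=` h @` setT.
  move=> x Ax.
  have xm k : (absz (x k 0%R) <= m)%N.
    apply: leq_trans (_ : (\max_(k < n) absz (x k 0%R) <= m))%N.
      exact: (leq_bigmax k).
    by apply: (@leq_bigmax_seq _ _ _ (fun x : 'cV[int]_n =>
      \max_(k < n) absz (x k 0%R))%N) => //; rewrite in_fset_set//;
        exact: mem_set.
  have fk k : (absz (x k 0 + m%:Z)%R < m.*2.+1)%N by move: (xm k); lia.
  exists [ffun k => Ordinal (fk k)] => //; apply/colP => k;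
    rewrite !mxE ffunE/=.
  by rewrite gez0_abs ?addrK//; exact: mge0 (xm k).
have hinj : set_inj setT h.
  move=> f g _ _ /colP hfg; apply/ffunP => k; apply: val_inj.
  by move: (hfg k); rewrite !mxE => /addIr [].
apply: (@le_trans _ _ (\sum_(x \in h @` setT) (\prod_(k < n) q ^+ absz (x k
  0%R))%:E)%E).
  apply: lee_fsum_nneg_subset => //.
  - exact: finite_image.
  - by move=> x /set_mem Ax; apply/mem_set/Ah.
  - by move=> x _; rewrite lee_fin prodr_ge0// => k _; exact: exprn_ge0.
rewrite fsbig_image//.
have -> : [set: {ffun 'I_n -> 'I_m.*2.+1}] =
    [set` index_enum {ffun 'I_n -> 'I_m.*2.+1}].
  by apply/seteqP; split => f _ //=; exact: mem_index_enum.
rewrite -fsbig_seq ?index_enum_uniq// sumEFin lee_fin.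
pose F (k : 'I_n) (j : 'I_m.*2.+1) := q ^+ `|(j%:Z - m%:Z)%R|%N.
rewrite (eq_bigr (fun f : {ffun _ -> _} => \prod_k F k (f k))); last first.
  by move=> f _; apply: eq_bigr => k _; rewrite mxE.
rewrite -(bigA_distr_bigA F) -[X in _ <= _ ^+ X]card_ord -prodr_const.
apply: ler_prod => k _; rewrite sumr_ge0 ?sum_expr_distn_le// => j _.
exact: exprn_ge0.
Qed.

End Summability.

(** * Enumeration of the lattice and convergence of its theta series *)

Section Lattice.
Context {R : realType} {n : nat} (M : 'M[R]_n).
Hypothesis (M_indep : row_free M^T).

Let Mu : M \in unitmx.
Proof. by rewrite -unitmx_tr -row_free_unit. Qed.

Lemma lattice_inj : injective (fun i : 'cV[int]_n => M *m map_mx intr i).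
Proof.
move=> i j /(congr1 (mulmx (invmx M))); rewrite !mulKmx// => /colP ij.
by apply/colP => k; move: (ij k); rewrite !mxE => /intr_inj.
Qed.

Lemma lattice_bij :
  set_bij setT (lattice M) (fun i : 'cV[int]_n => M *m map_mx intr i).
Proof.
split; [by move=> i _; exists i|by move=> i j _ _; exact: lattice_inj|].
by move=> _ [i _ <-]; exists i.
Qed.

Lemma lattice0 : lattice M 0.
Proof. by exists 0 => //; rewrite map_mx0 mulmx0. Qed.

(** Being the image of the integer vectors, the lattice is countable; constant vectors already give
    infinitely many points once there is a coordinate. An enumeration turns unordered sums into
    series over [nat]. *)
Lemma lattice_enum : (0 < n)%N ->
  exists e : nat -> 'cV[R]_n, set_bij setT (lattice M) e.
Proof.
move=> n0; suff /card_set_bijP : ([set: nat] #= lattice M)%card by [].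
rewrite card_eq_sym; apply: eq_card_nat.
  apply: card_le_trans (card_image_le _ _) _; exact: countableP.
apply/infiniteP/pcard_leP/injfunPex.
exists (fun k : nat => M *m map_mx intr (const_mx k%:Z : 'cV[int]_n)).
  by move=> k _; exists (const_mx k%:Z).
move=> k k' _ _ /lattice_inj /colP /(_ (Ordinal n0)).
by rewrite !mxE => -[].
Qed.

(** The inverse of M recovers the integer coordinates, so each is at most B |x| in absolute value.
    The l1 norm is the useful lower bound because its exponential factors over the coordinates. *)
Lemma sum_absz_lattice_le : exists2 K : R, 0 < K &
  forall i : 'cV[int]_n,
    \sum_(k < n) (absz (i k 0))%:R <= K * enorm (M *m map_mx intr i) ^+ 2.
Proof.
pose B : R := \sum_(k < n) \sum_(j < n) `|invmx M k j|.
(* The added 1 only makes K positive, so that c / K is positive later. *)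
exists (n%:R * B ^+ 2 + 1).
  by rewrite ltr_wpDl// mulr_ge0// sqr_ge0.
move=> i; set x := M *m _.
apply: (@le_trans _ _ (n%:R * B ^+ 2 * enorm x ^+ 2)); last first.
  by rewrite ler_wpM2r ?sqr_ge0// lerDl.
have -> : n%:R * B ^+ 2 * enorm x ^+ 2 = \sum_(k < n) (B * enorm x) ^+ 2.
  by rewrite sumr_const card_ord -[RHS]mulr_natl; ring.
apply: ler_sum => k _.
have xj j : `|x j 0| <= enorm x.
  rewrite -(@ler_pXn2r _ 2) ?nnegrE ?enorm_ge0//
    enorm_sqr real_normK ?num_real//.
  by rewrite (bigD1 j)//= lerDl sumr_ge0// => ? _; exact: sqr_ge0.
have ik : `|(i k 0)%:~R| <= B * enorm x :> R.
  have -> : (i k 0)%:~R = \sum_(j < n) invmx M k j * x j 0.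
    by have /colP/(_ k) := mulKmx Mu (map_mx intr i : 'cV[R]_n);
      rewrite -/x !mxE => <-.
  apply: le_trans (ler_norm_sum _ _ _) _.
  rewrite /B [X in _ <= X * _](bigD1 k)//= mulrDl ler_wpDr//.
    rewrite mulr_ge0 ?enorm_ge0// sumr_ge0// => ? _.
    by rewrite sumr_ge0.
  rewrite mulr_suml; apply: ler_sum => j _.
  by rewrite normrM ler_wpM2l.
(* An integer is at most its square in absolute value. *)
apply: (@le_trans _ _ (`|(i k 0)%:~R| ^+ 2)); last first.
  by rewrite ler_pXn2r ?nnegrE// (le_trans _ ik).
rewrite -intr_norm -abszE -natrX ler_nat.
by case: absz => // p; rewrite leq_pmulr.
Qed.

Lemma esum_lattice_expR_lty (c : R) : 0 < c ->
  (\esum_(l in lattice M) (expR (- (c * enorm l ^+ 2)))%:E < +oo)%E.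
Proof.
move=> c0; have [K K0 HK] := sum_absz_lattice_le.
rewrite (@reindex_esum _ _ _ _ _ _ _ lattice_bij).
pose q := expR (- (c / K)).
apply: (@le_lt_trans _ _ (\esum_(i in [set: 'cV[int]_n])
    (\prod_(k < n) q ^+ absz (i k 0%R))%:E)%E); last first.
  apply: esum_prod_expr_lty; rewrite ?expR_ge0// /q -expR0 ltr_expR oppr_lt0.
  by rewrite divr_gt0.
apply: le_esum => i _; rewrite lee_fin.
have -> : \prod_(k < n) q ^+ absz (i k 0) =
    expR (- (c / K * \sum_(k < n) (absz (i k 0))%:R)).
  rewrite mulr_sumr -sumrN expR_sum; apply: eq_bigr => k _.
  by rewrite /q -expRM_natl -mulr_natl mulrN mulrC.
rewrite ler_expR lerN2 -mulrA ler_pM2l// mulrC ler_pdivrMr// mulrC.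
exact: HK.
Qed.

End Lattice.

(** * Termwise differentiation of a series of exponentials *)

Section ExponentialSeries.
Context {R : realType} (b : nat -> R).
Hypotheses (b_ge0 : forall k, 0 <= b k)
  (b_lty : forall t, 0 < t -> (\sum_(k <oo) (expR (- (t * b k)))%:E < +oo)%E).
Local Notation count := (@counting nat R).

Let f t k := expR (- (t * b k)).

Let is_derive_f (t : R) (k : nat) : is_derive t 1 (f ^~ k) (- (b k * f t k)).
Proof.
rewrite /f; apply: is_derive_eq; rewrite /GRing.scale/=.
by rewrite mulr0 add0r mulr1 mulrN mulrC.
Qed.

Let integrable_f t : 0 < t -> count.-integrable setT (EFin \o f t).
Proof.
move=> t0; apply/integrableP; split => //.
rewrite ge0_integral_count//= (eq_eseriesr (g := fun k => (f t k)%:E)).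
  exact: b_lty.
by move=> k _; rewrite ger0_norm ?expR_ge0.
Qed.

(** For u > t / 2, the exponential at u is at most the square of the one at t / 4. One factor
    absorbs b, since e^y >= 1 + y at y = t b / 4 gives b e^(-y) <= 4 / t; the other stays
    summable. *)
Let G_ub t u k : 0 < t -> t / 2 < u ->
  b k * f u k <= 4 / t * f (t / 4) k.
Proof.
move=> t0 tu.
apply: (@le_trans _ _ (b k * (f (t / 4) k * f (t / 4) k))).
  rewrite ler_wpM2l// /f -expRD ler_expR -opprD lerN2 -mulrDl ler_wpM2r//.
  by apply: le_trans (ltW tu); rewrite le_eqVlt; apply/orP; left; apply/eqP;
    field.
rewrite mulrA ler_wpM2r ?expR_ge0// /f expRN ler_pdivrMr ?expR_gt0//.
rewrite mulrAC ler_pdivlMr//.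
have := expR_ge1Dx (t / 4 * b k); lra.
Qed.

(** The series is an integral against the counting measure, so differentiation under the integral
    sign applies, with a dominating function valid on a whole neighbourhood of t. *)
Lemma derivable_exp_series (t : R) : 0 < t ->
  let F u := fine (\sum_(k <oo) (expR (- (u * b k)))%:E)%E in
  derivable F t 1 /\
  (F^`()%classic t)%:E = (- \sum_(k <oo) (b k * expR (- (t * b k)))%:E)%E.
Proof.
move=> t0 F.
have FE : F = fun u => \int[count]_(k in setT) f u k.
  by apply/funext => u; rewrite /F /Rintegral ge0_integral_count// => k;
    rewrite lee_fin expR_ge0.
pose G k := 4 / t * f (t / 4) k.
(* The lower end t / 2 is what the domination requires; the upper end only has to exceed t. *)
have It : (`]t / 2, 2 * t[%classic : set R) t.
  by rewrite /= in_itv/=; apply/andP; split; lra.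
have Ipos u : (`]t / 2, 2 * t[%classic : set R) u -> 0 < u /\ t / 2 < u.
  by rewrite /= in_itv/= => /andP[tu _]; split => //; apply: lt_trans tu; lra.
have d1E u k : partial1of2 f u k = - (b k * f u k).
  rewrite partial1of2E; apply: derive_val; exact: is_derive_f.
have intf u : (`]t / 2, 2 * t[%classic : set R) u ->
    count.-integrable setT (EFin \o f u).
  by move=> /Ipos[u0 _]; exact: integrable_f.
have intG : count.-integrable setT (EFin \o G).
  rewrite /G (_ : _ \o _ = (fun k => (4 / t)%:E * (EFin \o f (t / 4)) k)%E);
    last first.
    by apply/funext => k.
  by apply: integrableZl => //; apply: integrable_f; rewrite divr_gt0.
have G0 k : 0 <= G k by rewrite mulr_ge0 ?expR_ge0// divr_ge0// ltW.
have derf u k : (`]t / 2, 2 * t[%classic : set R) u -> setT k -> derivable (f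
  ^~ k) u 1.
  by move=> _ _; have [] := is_derive_f u k.
have Gub u k : (`]t / 2, 2 * t[%classic : set R) u -> setT k ->
    `|partial1of2 f u k| <= G k.
  move=> /Ipos[u0 tu] _; rewrite d1E normrN ger0_norm ?mulr_ge0 ?expR_ge0//.
  exact: G_ub.
rewrite FE; split.
  exact: (derivable_under_integral measurableT It intf derf G0 intG Gub).
rewrite (differentiation_under_integral measurableT It intf derf G0 intG Gub).
rewrite /Rintegral.
under eq_integral do rewrite d1E EFinN.
rewrite integral_ge0N; last first.
  by move=> k _; rewrite lee_fin mulr_ge0 ?expR_ge0.
rewrite ge0_integral_count; last first.
  by move=> k; rewrite lee_fin mulr_ge0 ?expR_ge0.
(* Domination at u = t shows the differentiated series finite, so the real derivative can be read in
   the extended reals. *)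
rewrite fineK// fin_numN ge0_fin_numE; last first.
  by apply: nneseries_ge0 => k _ _; rewrite lee_fin mulr_ge0 ?expR_ge0.
apply: (@le_lt_trans _ _ (\sum_(k <oo) (G k)%:E)%E).
  apply: lee_nneseries => k _; first by rewrite lee_fin mulr_ge0 ?expR_ge0.
  by rewrite lee_fin G_ub//; lra.
have /integrableP[_] := intG; rewrite ge0_integral_count//=.
by under eq_eseriesr do rewrite ger0_norm//.
Qed.

End ExponentialSeries.

(** * Derivative of the theta series and distortion as a sum over cells *)

Section Enumeration.
Context {R : realType} {n : nat} (L : set 'cV[R]_n) (e : nat -> 'cV[R]_n).
Hypothesis e_bij : set_bij setT L e.

Lemma esum_enum (g : 'cV[R]_n -> \bar R) : (forall l, (0 <= g l)%E) ->
  (\esum_(l in L) g l = \sum_(k <oo) g (e k))%E.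
Proof.
by move=> g0; rewrite (@reindex_esum _ _ _ _ _ _ _ e_bij) nneseries_esumT.
Qed.

Lemma derivable_theta :
  (forall c, 0 < c -> (\esum_(l in L) (expR (- (c * enorm l ^+ 2)))%:E <
    +oo)%E) ->
  forall tau : R, 0 < tau ->
  derivable (theta L) tau 1 /\
  ((derive1 (theta L) tau)%:E =
   - \esum_(l in L)
       (pi * enorm l ^+ 2 * expR (- (pi * tau * enorm l ^+ 2)))%:E)%E.
Proof.
move=> Lfin tau tau0; pose b k : R := pi * enorm (e k) ^+ 2.
have b0 k : 0 <= b k by rewrite mulr_ge0 ?pi_ge0// sqr_ge0.
have expE u l : expR (- (pi * u * enorm l ^+ 2)) =
    expR (- (u * (pi * enorm l ^+ 2))) :> R by congr expR; ring.
have thetaE : theta L = fun u => fine (\sum_(k <oo) (expR (- (u * b k)))%:E)%E.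
  apply/funext => u; rewrite /theta esum_enum; last first.
    by move=> l; rewrite lee_fin expR_ge0.
  by congr fine; apply: eq_eseriesr => k _; rewrite expE.
have bfin u : 0 < u -> (\sum_(k <oo) (expR (- (u * b k)))%:E < +oo)%E.
  move=> u0; have := Lfin (pi * u) (mulr_gt0 (pi_gt0 R) u0).
  rewrite esum_enum; last by move=> l; rewrite lee_fin expR_ge0.
  by under eq_eseriesr do rewrite expE.
have [dF F'E] := derivable_exp_series b0 bfin tau0.
rewrite thetaE; split => //; rewrite F'E esum_enum; last first.
  by move=> l; rewrite lee_fin mulr_ge0 ?expR_ge0// mulr_ge0 ?pi_ge0// sqr_ge0.
by congr (- _)%E; apply: eq_eseriesr => k _; rewrite expE.
Qed.

Context (Q : 'cV[R]_n -> 'cV[R]_n) (Q_nn : nearest_neighbor_quantizer L Q).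
Context d (T : measurableType d) (P : probability T R) (Z : 'I_n -> {RV P >->
  R}).

(** The events that Z falls in a given cell form a countable partition of the sample space, and the
    integrand is constant on each. As it is nonnegative, the integral splits without any finiteness
    assumption. *)
Lemma channel_distortionE :
  channel_distortion Q Z =
  ((n%:R^-1)%:E * \esum_(l in L)
     ((enorm l ^+ 2)%:E * P (random_vector Z @^-1` voronoi_cell Q l)))%E.
Proof.
congr (_ * _)%E.
pose V k := random_vector Z @^-1` voronoi_cell Q (e k).
have mV k : measurable (V k) := measurable_voronoi Z Q_nn (e k).
have UV : \bigcup_k V k = setT.
  apply/seteqP; split => // w _.
  have [] := Q_nn.2 (random_vector Z w).
  have [_ _ /[apply] -[k _ ekw] _] := e_bij.
  by exists k => //; rewrite /V/=.
have tV : trivIset setT V.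
  apply/trivIsetP => i j _ _ ij; apply/seteqP; split => // w [].
  rewrite /V /voronoi_cell/= => -> eij.
  have [_ einj _] := e_bij.
  by move/eqP: ij; apply; exact: (einj _ _ (mem_set I) (mem_set I) eij).
have mf : measurable_fun setT (fun w =>
  (enorm (Q (random_vector Z w)) ^+ 2)%:E).
  apply/measurable_EFinP.
  exact: (measurableT_comp measurable_enorm_sqr
    (measurableT_comp Q_nn.1 (measurable_random_vector Z))).
rewrite esum_enum; last by move=> l; rewrite mule_ge0// lee_fin sqr_ge0.
rewrite unlock -UV ge0_integral_bigcup//; last 2 first.
- by rewrite UV.
- by move=> w _; rewrite lee_fin sqr_ge0.
apply: eq_eseriesr => k _.
rewrite (eq_integral (fun=> (enorm (e k) ^+ 2)%:E)).
  by rewrite integral_cst.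
by move=> w /set_mem Vw; rewrite /= Vw.
Qed.

End Enumeration.

(** * Termwise comparison of the distortion with the theta derivative *)

Theorem theorem2 (R : realType) (n : nat) (n_gt0 : (0 < n)%N)
    (M : 'M[R]_n) (M_indep : row_free M^T)
    (Q : 'cV[R]_n -> 'cV[R]_n)
    (Q_nn : nearest_neighbor_quantizer (lattice M) Q)
    (sigma : R) (sigma_gt0 : 0 < sigma)
    (d : measure_display) (T : measurableType d) (P : probability T R)
    (Z : 'I_n -> {RV P >-> R}) (Z_iid : iid_gaussian Z sigma) :
  [/\ channel_distortion Q Z =
        ((n%:R^-1)%:E *
         \esum_(l in lattice M)
           ((enorm l ^+ 2)%:E *
            P (random_vector Z @^-1` voronoi_cell Q l)))%E,
      forall tau : R, 0 < tau ->
        derivable (theta (lattice M)) tau 1 /\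
        ((derive1 (theta (lattice M)) tau)%:E =
         - \esum_(l in lattice M)
             (pi * enorm l ^+ 2 * expR (- (pi * tau * enorm l ^+ 2)))%:E)%E
    & (channel_distortion Q Z <=
       (- (2 * pi * n%:R)^-1 *
          derive1 (theta (lattice M)) (8 * pi * sigma ^+ 2)^-1)%:E)%E].
Proof.
have [e e_bij] := lattice_enum M_indep n_gt0.
have Dtheta := derivable_theta e_bij (esum_lattice_expR_lty M_indep).
split => //; first exact: (channel_distortionE e_bij Q_nn).
rewrite (channel_distortionE e_bij Q_nn).
set tau := (8 * pi * sigma ^+ 2)^-1.
have pi0 := pi_gt0 R.
have tau0 : 0 < tau.
  rewrite invr_gt0; apply: mulr_gt0; last exact: exprn_gt0.
  by apply: mulr_gt0.
have [_ D] := Dtheta tau tau0.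
have n0 : 0 < n%:R :> R by rewrite ltr0n.
(* The two minus signs cancel, and isolating 1 / n lets it be removed from both sides. *)
have -> : (- (2 * pi * n%:R)^-1 * (theta (lattice M))^`()%classic tau)%:E =
    ((n%:R^-1)%:E * ((2 * pi)^-1%:E * \esum_(l in lattice M)
       (pi * enorm l ^+ 2 * expR (- (pi * tau * enorm l ^+ 2)))%:E))%E.
  rewrite -[X in (_ * (_ * X))%E]oppeK -D -EFinN -!EFinM; congr EFin.
  by rewrite invfM mulrN mulNr [RHS]mulrN mulrA [n%:R^-1 * _]mulrC.
rewrite lee_pmul2l// ?lte_fin ?invr_gt0//.
rewrite !(esum_enum e_bij); last 2 first.
- by move=> l; rewrite lee_fin mulr_ge0 ?expR_ge0// mulr_ge0 ?pi_ge0// sqr_ge0.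
- by move=> l; rewrite mule_ge0// lee_fin sqr_ge0.
rewrite -nneseriesZl; last first.
  by move=> k _;
    rewrite lee_fin mulr_ge0 ?expR_ge0// mulr_ge0 ?pi_ge0// sqr_ge0.
apply: lee_nneseries => k _; first by rewrite mule_ge0// lee_fin sqr_ge0.
have [->|ek0] := eqVneq (e k) 0.
  by rewrite enorm0 expr0n/= mul0e mulr0 mul0r mule0.
have := voronoi_cell_prob_le sigma_gt0 Z_iid Q_nn (lattice0 M) ek0.
move=> /(lee_wpmul2l _) => /(_ (enorm (e k) ^+ 2)%:E);
  rewrite lee_fin sqr_ge0 => /(_ isT).
move=> /le_trans; apply; rewrite -!EFinM lee_fin le_eqVlt; apply/orP; left;
  apply/eqP.
(* The value of tau makes the exponents coincide, and pi / (2 pi) is the 1/2 of the tail bound: the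
   two terms are equal. *)
have -> : pi * tau * enorm (e k) ^+ 2 = enorm (e k) ^+ 2 / (8 * sigma ^+ 2).
  rewrite /tau; move: (gt_eqF pi0) (gt_eqF sigma_gt0).
  by move: pi => p /negbT p0 /negbT s0; field; rewrite s0.
by move: pi (gt_eqF pi0) => p /negbT p0; field.
Qed.
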